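(* (a) If $G$ and $H$ are (not necessarily connected) graphs with clique number at least two, and $G$ and $H$ are not both complete graphs, then $$\min\{\omega(G),\omega(H)\}+1\le \mathrm{mob}(G\vee H)\le \omega(G)+\omega(H)-1.$$ (b) For any graph $G$ of order $n\ge 2$, $2\le \mathrm{mob}(G\vee K_1)\le \omega(G)+1$.
   Context: $\omega(G)$ is the clique number of $G$. The join $G\vee H$ is the disjoint union of $G$ and $H$ with all edges between $V(G)$ and $V(H)$ added. A set $S\subseteq V(G)$ is a general position set if no three vertices of $S$ lie on a common shortest path. Robots are placed one per vertex of a general position set $S$; a move $u\to v$ along an edge $uv$ with $u\in S$ is legal if $v\notin S$ and $(S\setminus\{u\})\cup\{v\}$ is a general position set. $S$ is a mobile general position set if some sequence of legal moves starting from $S$ visits every vertex at least once; $\mathrm{mob}(G)$ is the maximum size of a mobile general position set. *)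

(* Defs.v *)
From HB Require Import structures.
From mathcomp Require Import all_boot.
From mathcomp Require Import boolp.

Set Implicit Arguments.
Unset Strict Implicit.
Unset Printing Implicit Defensive.

Record sgraph := SGraph {
  vertex :> finType;
  edge : rel vertex;
  edge_sym : symmetric edge;
  edge_irr : irreflexive edge
}.

Section CompleteGraph.
Variable n : nat.

Definition complete_edge : rel 'I_n := fun x y => x != y.

Lemma complete_edge_sym : symmetric complete_edge.
Proof. by move=> x y; rewrite /complete_edge eq_sym. Qed.

Lemma complete_edge_irr : irreflexive complete_edge.
Proof. by move=> x; rewrite /complete_edge eqxx. Qed.

Definition complete_graph : sgraph :=
  SGraph complete_edge_sym complete_edge_irr.
End CompleteGraph.

Section Join.
Variables G H : sgraph.

Definition join_edge : rel (G + H)%type := fun x y =>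
  match x, y with
  | inl a, inl b => edge a b
  | inr a, inr b => edge a b
  | _, _ => true
  end.

Lemma join_edge_sym : symmetric join_edge.
Proof. by move=> [a|a] [b|b] //=; apply: edge_sym. Qed.

Lemma join_edge_irr : irreflexive join_edge.
Proof. by move=> [a|a] /=; apply: edge_irr. Qed.

Definition join : sgraph := SGraph join_edge_sym join_edge_irr.
End Join.

Section MobileGeneralPosition.
Variable G : sgraph.
Implicit Types (S T K : {set G}).

Definition is_complete : Prop := forall x y : G, x != y -> edge x y.

Definition clique K : bool :=
  [forall x in K, forall y in K, (x != y) ==> edge x y].

Definition omega : nat := \max_(K : {set G} | clique K) #|K|.

(* The vertex sequence of the path is [x :: p]; its length is [size p]. *)
Definition shortest_path (x : G) (p : seq G) : Prop :=
  path (@edge G) x p /\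
  forall q : seq G, path (@edge G) x q -> last x q = last x p ->
    size p <= size q.

Definition general_position S : Prop :=
  forall u v w : G, u \in S -> v \in S -> w \in S -> uniq [:: u; v; w] ->
    ~ exists (x : G) (p : seq G),
        shortest_path x p /\ {subset [:: u; v; w] <= x :: p}.

Definition legal_move : rel {set G} := fun S T =>
  [exists u, exists v,
     [&& u \in S, v \notin S, edge u v, T == v |: (S :\ u)
       & `[< general_position T >]]].

(* [Ss] lists the configurations after each move; the vertices occupied in the
   initial configuration [S] count as visited. *)
Definition mobile S : Prop :=
  general_position S /\
  exists Ss : seq {set G},
    path legal_move S Ss /\
    forall v : G, exists2 T, T \in S :: Ss & v \in T.

Definition mob : nat := \max_(S : {set G} | `[< mobile S >]) #|S|.
End MobileGeneralPosition.

(* Main.v *)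
(* In a graph of diameter at most two, general position means inducing a
   disjoint union of cliques; in a join, a general position set meeting both
   sides is therefore a clique. Legal moves are reversible, so mobility only
   asks that every vertex be reachable from one configuration.

   Lower bound: take cliques A, B of size m = min(omega G, omega H) on the two
   sides. All (m+1)-subsets of the clique A + B are mutually reachable, and from
   a suitable one a robot can step onto any given outside vertex.

   Upper bound: a configuration of at least omega G + omega H robots meeting
   both sides is a clique of maximum size and admits no move in or out, so the
   robots either never move or never leave their side. *)

Require Import Defs.
From HB Require Import structures.
From mathcomp Require Import all_boot.
From mathcomp Require Import boolp.
From mathcomp Require Import zify.

Set Implicit Arguments.
Unset Strict Implicit.
Unset Printing Implicit Defensive.

(** * Cliques and the clique number *)

Lemma exists_subset_card (T : finType) (K : {set T}) (m : nat) :
  m <= #|K| -> exists2 K' : {set T}, K' \subset K & #|K'| = m.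
Proof.
rewrite -bin_gt0 -cards_draws => /card_gt0P[K'].
by rewrite inE => /andP[sK /eqP cK]; exists K'.
Qed.

Lemma cliqueP (G : sgraph) (K : {set G}) :
  reflect {in K &, forall x y, x != y -> edge x y} (clique K).
Proof.
apply: (iffP 'forall_in_'forall_in_implyP) => h x; first by move=> y xK; apply: h.
by move=> xK y; apply: h.
Qed.

Lemma clique_sub (G : sgraph) (K L : {set G}) :
  K \subset L -> clique L -> clique K.
Proof.
move=> /subsetP sKL /cliqueP cL.
by apply/cliqueP => x y /sKL xL /sKL yL; apply: cL.
Qed.

Lemma clique_setU1 (G : sgraph) (K : {set G}) (v : G) :
  clique K -> {in K, forall x, x != v -> edge v x} -> clique (v |: K).
Proof.
move=> /cliqueP cK vK; apply/cliqueP => x y.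
rewrite !in_setU1 => /orP[/eqP->|xK] /orP[/eqP->|yK].
- by rewrite eqxx.
- by rewrite eq_sym; apply: vK.
- by rewrite edge_sym; apply: vK.
- exact: cK.
Qed.

Lemma clique_card_le (G : sgraph) (K : {set G}) : clique K -> #|K| <= omega G.
Proof. by move=> cK; apply: (leq_bigmax_cond (F := fun K : {set G} => #|K|)). Qed.

Lemma exists_clique_card (G : sgraph) (m : nat) :
  m <= omega G -> exists2 K : {set G}, clique K & #|K| = m.
Proof.
(* The empty clique makes the family nonempty, so the maximum defining [omega] is attained. *)
have cl0 : clique (set0 : {set G}) by apply/cliqueP => x y; rewrite inE.
have /(eq_bigmax_cond (fun K : {set G} => #|K|))[K cK omE] : 0 < #|@clique G|.
  by apply/card_gt0P; exists set0.
rewrite /omega omE => /exists_subset_card[L sLK <-].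
by exists L => //; apply: clique_sub sLK cK.
Qed.

(** * General position in graphs of diameter at most two *)

Definition diam_le2 (G : sgraph) : Prop :=
  forall x y : G, exists q : seq G,
    [/\ path (@edge G) x q, last x q = y & size q <= 2].

(** Equivalently, [S] induces no path on three vertices, so it induces a disjoint union of
    cliques. *)
Definition cluster (G : sgraph) (S : {set G}) : Prop :=
  {in S & &, forall x y z, edge x y -> edge y z -> x != z -> edge x z}.

(** An induced path on three vertices is a shortest path: a shorter walk with the same ends would be
    trivial or the missing edge. *)
Lemma general_position_cluster (G : sgraph) (S : {set G}) :
  general_position S -> cluster S.
Proof.
move=> gpS x y z xS yS zS exy eyz xz; apply: contraT => nxz.
have neq_edge a b : edge a b -> a != b :> G.
  by apply: contraTneq => ->; rewrite edge_irr.
case: (gpS x y z xS yS zS).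
  by rewrite /= !inE negb_or xz (neq_edge _ _ exy) (neq_edge _ _ eyz).
exists x, [:: y; z]; split=> //; split; first by rewrite /= exy eyz.
move=> [|a [|b q]] //=; first by move=> _ /eqP; rewrite (negbTE xz).
by rewrite andbT => exa az; rewrite az (negbTE nxz) in exa.
Qed.

(** A shortest path has at most three vertices here, so one through three vertices of [S] consists
    of exactly these, and the cluster property provides an edge that shortcuts it. *)
Lemma cluster_general_position (G : sgraph) (S : {set G}) :
  diam_le2 G -> cluster S -> general_position S.
Proof.
move=> dG clS u v w uS vS wS uni [x [p [[pp pmin] sub]]].
have [q [qp ql qs]] := dG x (last x p).
have sp2 : size p <= 2 by apply: leq_trans (pmin q qp ql) qs.
have [|_] := uniq_min_size uni sub; first by rewrite /= ltnS.
have sub' : {subset x :: p <= S}.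
  have [_ eqi] := uniq_min_size uni sub sp2.
  by move=> a; rewrite -eqi !inE => /or3P[]/eqP->.
have sp : 3 <= size (x :: p) by apply: uniq_leq_size uni sub.
case: p pp pmin sub sub' sp2 sp {q qp ql qs} => [|y [|z [|? ?]]] //=.
rewrite andbT => /andP[exy eyz] pmin sub sub' _ _ eqi.
have xz : x != z.
  apply/eqP => E; subst z; have := pmin [::]; rewrite /=.
  by move=> /(_ isT erefl).
have exz : edge x z.
  by apply: (clS x y z) => //; apply: sub'; rewrite !inE eqxx ?orbT.
by have := pmin [:: z]; rewrite /= exz => /(_ isT erefl).
Qed.

Lemma clique_general_position (G : sgraph) (K : {set G}) :
  diam_le2 G -> clique K -> general_position K.
Proof.
move=> dG /cliqueP cK; apply: cluster_general_position => //.
by move=> x y z xK _ zK _ _; apply: cK.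
Qed.

Lemma general_position_card2 (G : sgraph) (S : {set G}) :
  #|S| <= 2 -> general_position S.
Proof.
move=> cS u v w uS vS wS uni _; have : 2 < #|S|; last by rewrite ltnNge cS.
by apply/card_geqP; exists [:: u; v; w]; split=> // x; rewrite !inE => /or3P[]/eqP->.
Qed.

(** * Legal moves and reachability *)

Lemma legal_moveP (G : sgraph) (S T : {set G}) :
  reflect (exists u v, [/\ u \in S, v \notin S, edge u v, T = v |: (S :\ u)
                         & general_position T])
          (legal_move S T).
Proof.
apply: (iffP existsP) => [[u /existsP[v /and5P[? ? ? /eqP ? /asboolP ?]]]|].
  by exists u, v.
move=> [u [v [uS vS euv -> gp]]]; exists u; apply/existsP; exists v.
by rewrite uS vS euv eqxx; apply/asboolP.
Qed.

Lemma legal_move_gp (G : sgraph) (S T : {set G}) :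
  legal_move S T -> general_position T.
Proof. by case/legal_moveP => u [v []]. Qed.

Lemma legal_move_card (G : sgraph) (S T : {set G}) :
  legal_move S T -> #|T| = #|S|.
Proof.
case/legal_moveP => u [v [uS vS _ -> _]].
by rewrite cardsU1 !inE (negbTE vS) andbF (cardsD1 u S) uS.
Qed.

(** A legal move checks general position only at its target, so undoing it requires the source to be
    in general position too. *)
Lemma legal_move_sym (G : sgraph) (S T : {set G}) :
  general_position S -> legal_move S T -> legal_move T S.
Proof.
move=> gpS /legal_moveP[u [v [uS vS euv -> _]]]; apply/legal_moveP.
have uv : u != v by apply: contraNneq vS => <-.
exists v, u; rewrite edge_sym; split => //.
- by rewrite !inE eqxx.
- by rewrite !inE (negbTE uv) eqxx.
- by rewrite setU1K ?setD1K // !inE (negbTE vS) andbF.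
Qed.

Lemma connect_legal_move_sym (G : sgraph) (S T : {set G}) :
  general_position S -> connect (@legal_move G) S T ->
  connect (@legal_move G) T S.
Proof.
move=> gpS /connectP[p]; elim: p S gpS => [|U p IH] S gpS /=.
  by move=> _ ->; apply: connect0.
move=> /andP[lSU pU] TE; apply: connect_trans (IH U (legal_move_gp lSU) pU TE) _.
by apply/connect1/legal_move_sym.
Qed.

(** For each vertex, make a round trip from [S] to a configuration occupying it; reversibility
    supplies the way back. *)
Lemma mobile_connect (G : sgraph) (S : {set G}) :
  general_position S ->
  (forall v : G, exists2 T, connect (@legal_move G) S T & v \in T) ->
  mobile S.
Proof.
move=> gpS reach; split=> //.
(* Requiring the walk to return to [S] lets the round trips be concatenated by induction on the list
   of vertices. *)
suff [Ss [pS _ vis]] : exists Ss, [/\ path (@legal_move G) S Ss, last S Ss = S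
    & {in enum G, forall v, exists2 T, T \in S :: Ss & v \in T}].
  by exists Ss; split=> // v; apply: vis; rewrite mem_enum.
elim: (enum G) => [|v s [Ss [pS lS vis]]]; first by exists [::].
have [T ST vT] := reach v.
have /connectP[q pq lq] := connect_legal_move_sym gpS ST.
have /connectP[p pp lp] := ST.
exists (p ++ q ++ Ss); split.
- by rewrite !cat_path pp -lp pq -lq.
- by rewrite !last_cat -lp -lq.
- move=> w; rewrite inE => /predU1P[->|/vis[U UI wU]].
    by exists T; rewrite // lp -cat_cons mem_cat mem_last.
  exists U => //; move: UI; rewrite !inE !mem_cat => /orP[->//|->].
  by rewrite !orbT.
Qed.

(** * Robots moving within a clique and stepping out of it *)

Lemma connect_in_clique (G : sgraph) (C S T : {set G}) :
  diam_le2 G -> clique C -> S \subset C -> T \subset C -> #|S| = #|T| ->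
  connect (@legal_move G) S T.
Proof.
move=> dG cC; have [n] := ubnP #|S :\: T|; elim: n S => // n IH S ltn sSC sTC cST.
have [sST|/subsetPn[u uS uT]] := boolP (S \subset T).
  suff -> : S = T by apply: connect0.
  by apply/eqP; rewrite eqEcard sST cST leqnn.
have /subsetPn[v vT vS] : ~~ (T \subset S).
  apply/negP => sTS; have E : T = S by apply/eqP; rewrite eqEcard sTS cST leqnn.
  by rewrite E uS in uT.
have uC := subsetP sSC u uS; have vC := subsetP sTC v vT.
(* Moving the robot on [u], outside [T], to [v] in [T] stays inside [C], hence in general position,
   and shrinks the difference from [T]. *)
have sS'C : v |: (S :\ u) \subset C.
  by rewrite subUset sub1set vC (subset_trans (subsetDl _ _) sSC).
have lS : legal_move S (v |: (S :\ u)).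
  apply/legal_moveP; exists u, v; split=> //.
    by apply: (cliqueP _ cC) => //; apply: contraNneq uT => ->.
  exact/(clique_general_position dG)/(clique_sub sS'C).
apply: connect_trans (connect1 lS) _; apply: IH => //.
  have -> : (v |: (S :\ u)) :\: T = (S :\: T) :\ u.
    apply/setP => x; rewrite !inE.
    by case: (eqVneq x v) => [->|_] //=; rewrite ?vT ?andbF //= andbCA.
  by move: ltn; rewrite (cardsD1 u (S :\: T)) !inE uS uT.
by rewrite (legal_move_card lS).
Qed.

(* Park the robots on the neighbours of [v] in [A] and fill up with vertices of
   [B]; then a robot of [B] can step onto [v]. If [v] has no neighbour in [A],
   the robot leaving [B] from [A] plus one vertex of [B] ends on an isolated vertex. *)
Lemma two_cliques_reach (G : sgraph) (A B : {set G}) (m : nat) (v : G) :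
  diam_le2 G -> clique (A :|: B) -> [disjoint A & B] ->
  0 < m -> #|A| = m -> #|B| = m ->
  v \notin A :|: B -> {in B, forall b, edge v b} ->
  exists T T' : {set G},
    [/\ T \subset A :|: B, #|T| = m.+1, legal_move T T' & v \in T'].
Proof.
move=> dG cAB dAB m0 cA cB; rewrite inE negb_or => /andP[vA vB] evB.
have cardAB (X Y : {set G}) : X \subset A -> Y \subset B -> #|X :|: Y| = #|X| + #|Y|.
  move=> sX sY; rewrite cardsU (_ : X :&: Y = set0) ?cards0 ?subn0 //.
  by apply/disjoint_setI0/(disjointW sX sY).
suff [X [B' [b [sX sB' bB' cT gp]]]] : exists (X B' : {set G}) b,
    [/\ X \subset A, B' \subset B, b \in B', #|X| + #|B'| = m.+1
      & general_position (v |: ((X :|: B') :\ b))].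
  exists (X :|: B'), (v |: ((X :|: B') :\ b)); split.
  - exact: setUSS.
  - by rewrite cardAB.
  - apply/legal_moveP; exists b, v; split=> //; first by rewrite inE bB' orbT.
    - by rewrite inE negb_or (contra (subsetP sX v)) // (contra (subsetP sB' v)).
    - by rewrite edge_sym evB // (subsetP sB').
  - by rewrite !inE eqxx.
pose N := [set a in A | edge v a].
have sNA : N \subset A by apply/subsetP => x; rewrite inE => /andP[].
have [N0|Nn0] := posnP #|N|.
  have /card_gt0P[b bB] : 0 < #|B| by rewrite cB.
  have bA : b \notin A by rewrite (disjointFl dAB bB).
  exists A, [set b], b; split; rewrite ?sub1set ?inE //.
    by rewrite cards1 cA addn1.
  rewrite [A :|: _]setUC setU1K //; apply: cluster_general_position => //.
  have nv a : a \in A -> edge v a = false.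
    move=> aA; apply: contraTF isT => eva; move/eqP: N0; rewrite cards_eq0.
    by move/eqP/setP/(_ a); rewrite !inE aA eva.
  have nv' a : a \in v |: A -> edge v a = false.
    by rewrite in_setU1 => /predU1P[->|/nv//]; rewrite edge_irr.
  move=> x y z xA yA zA; have [->|xv] := eqVneq x v; first by rewrite nv'.
  have [->|zv] := eqVneq z v; first by rewrite [edge y v]edge_sym nv'.
  move=> _ _; apply: (cliqueP _ cAB).
    by move: xA; rewrite !inE (negbTE xv) => /= ->.
  by move: zA; rewrite !inE (negbTE zv) => /= ->.
have leN : #|N| <= m by rewrite -cA subset_leq_card.
(* Since [N] is nonempty, [B] has enough vertices to fill up; since [N] has at most [m], at least
   one robot stands on [B]. *)
have [|B' sB' cB'] := @exists_subset_card _ B (m.+1 - #|N|); first by rewrite cB; lia.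
have /card_gt0P[b bB'] : 0 < #|B'| by rewrite cB'; lia.
exists N, B', b; split=> //; first by rewrite cB'; lia.
apply: clique_general_position => //.
have sNB : N :|: B' \subset A :|: B by apply: setUSS.
apply: clique_setU1; first exact: clique_sub (subset_trans (subsetDl _ _) sNB) cAB.
move=> x; rewrite !inE => /andP[_ /orP[/andP[]//|/(subsetP sB')/evB//]].
Qed.

(** The last hypothesis abstracts the join: a vertex on one side is adjacent to the whole clique on
    the other. *)
Lemma two_cliques_mob (G : sgraph) (A B : {set G}) (m : nat) :
  diam_le2 G -> clique (A :|: B) -> [disjoint A & B] ->
  0 < m -> #|A| = m -> #|B| = m ->
  (forall v, {in A, forall a, edge v a} \/ {in B, forall b, edge v b}) ->
  m.+1 <= mob G.
Proof.
move=> dG cAB dAB m0 cA cB adj.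
have cC : #|A :|: B| = m + m by rewrite cardsU disjoint_setI0 // cards0 subn0 cA cB.
have [|S sS cS] := @exists_subset_card _ (A :|: B) m.+1; first by rewrite cC; lia.
rewrite -cS.
apply: (leq_bigmax_cond (F := fun S : {set G} => #|S|)); apply/asboolP/mobile_connect.
  exact/(clique_general_position dG)/(clique_sub sS).
move=> v; have [vC|vC] := boolP (v \in A :|: B).
  have [|T sT cT] := @exists_subset_card _ ((A :|: B) :\ v) m.
    by have := cardsD1 v (A :|: B); rewrite cC vC; lia.
  exists (v |: T); last by rewrite !inE eqxx.
  apply: (connect_in_clique dG cAB sS).
    by rewrite subUset sub1set vC (subset_trans sT) ?subsetDl.
  rewrite cS cardsU1 cT (contra (subsetP sT v)) ?add1n //.
  by rewrite !inE eqxx.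
suff [T [T' [sT cT lT vT]]] : exists T T' : {set G},
    [/\ T \subset A :|: B, #|T| = m.+1, legal_move T T' & v \in T'].
  exists T' => //; apply: connect_trans (connect1 lT).
  by apply: connect_in_clique sS sT _ => //; rewrite cS cT.
(* The two cliques play symmetric roles: the one fully adjacent to [v] is taken as the second. *)
have [vA|vB] := adj v; last exact: two_cliques_reach.
by rewrite setUC; apply: two_cliques_reach; rewrite // 1?setUC // disjoint_sym.
Qed.

(** * Joins and their lower bound *)

Lemma join_diam_le2 (G H : sgraph) (g : G) (h : H) : diam_le2 (join G H).
Proof.
move=> [x|x] [y|y].
(* Vertices on the same side are linked through the given vertex of the other side. *)
- by exists [:: inr h; inl y].
- by exists [:: inr y].
- by exists [:: inl y].
- by exists [:: inl g; inr y].
Qed.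

Lemma omega_le_card (G : sgraph) : omega G <= #|G|.
Proof. by apply/bigmax_leqP => K _; apply: max_card. Qed.

Lemma mob_join_ge (G H : sgraph) :
  0 < omega G -> 0 < omega H ->
  minn (omega G) (omega H) + 1 <= mob (join G H).
Proof.
move=> oG oH; have /card_gt0P[g _] := leq_trans oG (omega_le_card G).
have /card_gt0P[h _] := leq_trans oH (omega_le_card H).
have [A cA mA] := exists_clique_card (geq_minl (omega G) (omega H)).
have [B cB mB] := exists_clique_card (geq_minr (omega G) (omega H)).
rewrite addn1; set m := minn _ _ in mA mB *.
have inlI : injective (@inl G H) by move=> x y [].
have inrI : injective (@inr G H) by move=> x y [].
pose A' : {set join G H} := [set inl x | x in A].
pose B' : {set join G H} := [set inr x | x in B].
apply: (@two_cliques_mob _ A' B'); rewrite ?card_imset ?leq_min ?oG //.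
- exact: join_diam_le2.
- apply/cliqueP => x y; rewrite !inE.
  move=> /orP[]/imsetP[x' xI ->] /orP[]/imsetP[y' yI ->] //= ne.
  + by apply: (cliqueP _ cA).
  + by apply: (cliqueP _ cB).
- apply/pred0P => x /=; apply/negP => /andP[/imsetP[a _ ->] /imsetP[b _]] //.
- by move=> [v|v]; [right|left] => x /imsetP[y _ ->].
Qed.

(** * The upper bound for joins *)

Definition on_side (G H : sgraph) (b : bool) (x : join G H) : bool :=
  if x is inl _ then b else ~~ b.

Lemma clique_side_card (G H : sgraph) (K : {set join G H}) (b : bool) :
  clique K ->
  #|[set x in K | on_side b x]| <= if b then omega G else omega H.
Proof.
move=> /cliqueP cK; case: b.
- pose L : {set G} := [set x | inl x \in K].
  have cL : clique L.
    by apply/cliqueP => x y; rewrite !inE => xK yK ne; apply: (cK (inl x) (inl y)).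
  apply: leq_trans (clique_card_le cL).
  apply: leq_trans (leq_imset_card (inl : G -> join G H) (mem L)).
  apply/subset_leq_card/subsetP => -[x|x]; rewrite !inE ?andbF // => /andP[xK _].
  by apply/imsetP; exists x; rewrite ?inE.
- pose L : {set H} := [set x | inr x \in K].
  have cL : clique L.
    by apply/cliqueP => x y; rewrite !inE => xK yK ne; apply: (cK (inr x) (inr y)).
  apply: leq_trans (clique_card_le cL).
  apply: leq_trans (leq_imset_card (inr : H -> join G H) (mem L)).
  apply/subset_leq_card/subsetP => -[x|x]; rewrite !inE ?andbF // => /andP[xK _].
  by apply/imsetP; exists x; rewrite ?inE.
Qed.

Lemma card_sides (G H : sgraph) (S : {set join G H}) (b : bool) :
  #|S| = #|[set x in S | on_side b x]| + #|[set x in S | on_side (~~ b) x]|.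
Proof.
rewrite -(cardsID [set x | on_side b x] S); congr (_ + _); apply: eq_card => x.
  by rewrite !inE.
by rewrite !inE andbC; case: x => x /=; case: b.
Qed.

Lemma join_clique_card (G H : sgraph) (K : {set join G H}) :
  clique K -> #|K| <= omega G + omega H.
Proof.
by move=> cK; rewrite (card_sides K true); apply: leq_add; apply: (clique_side_card _ cK).
Qed.

Definition mixed (G H : sgraph) (S : {set join G H}) : bool :=
  [forall b, exists x in S, on_side b x].

Lemma mixedPn (G H : sgraph) (S : {set join G H}) :
  ~~ mixed S -> exists b, {in S, forall x, on_side b x}.
Proof.
rewrite negb_forall => /existsP[b]; rewrite negb_exists => /forallP nS.
by exists (~~ b) => x xS; move: (nS x); rewrite xS; case: (x) => ?; case: (b).
Qed.

(** Two vertices on one side have a common neighbour in [S] on the other, so the cluster property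
    makes them adjacent. *)
Lemma mixed_clique (G H : sgraph) (S : {set join G H}) :
  general_position S -> mixed S -> clique S.
Proof.
move=> /general_position_cluster clS /forallP mS; apply/cliqueP => x y xS yS ne.
have /existsP[[a|a] /andP[aS //]] := mS true; have /existsP[[b|b] /andP[bS //]] := mS false.
case: x y xS yS ne => [x|x] [y|y] xS yS ne // _ _.
- by apply: (clS (inl x) (inr b) (inl y)).
- by apply: (clS (inr x) (inl a) (inr y)).
Qed.

(* A large mixed configuration has a second robot on each side, so it stays
   mixed after a move [u -> v]; then adding [v] gives a clique that is too large. *)
Lemma mixed_stuck (G H : sgraph) (S T : {set join G H}) :
  2 <= omega G -> 2 <= omega H -> general_position S ->
  omega G + omega H <= #|S| -> mixed S -> legal_move S T -> False.
Proof.
move=> oG oH gpS leS mS /legal_moveP[u [v [uS vS euv TE gpT]]].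
have cS := mixed_clique gpS mS.
have mT : mixed T.
  apply/forallP => b.
  (* The opposite side holds at most its clique number of robots, so this side holds at least its
     own, which is two or more. *)
  have : 1 < #|[set x in S | on_side b x]|.
    have := clique_side_card (~~ b) cS; have := card_sides S b.
    move: leS; move: #|S| #|_| #|_| => s p q.
    by case: (b) => /=; lia.
  rewrite (cardsD1 u) => c2.
  have /card_gt0P[x] : 0 < #|[set x in S | on_side b x] :\ u|.
    by case: (u \in _) c2 => /=; lia.
  rewrite !inE => /and3P[xu xS xb]; apply/existsP; exists x.
  by rewrite TE !inE xu xS orbT.
have cT := mixed_clique gpT mT.
have cU : clique (v |: S).
  apply: clique_setU1 => // x xS xv.
  have [->|xu] := eqVneq x u; first by rewrite edge_sym.
  by apply: (cliqueP _ cT); rewrite 1?eq_sym // TE !inE ?eqxx // xu xS orbT.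
by have := join_clique_card cU; rewrite cardsU1 vS; lia.
Qed.

(** A mixed [S] cannot be left and, by reversing the move, a mixed [T] cannot be entered. Both lie
    on one side, and a robot that did not move shows that it is the same side. *)
Lemma legal_move_same_side (G H : sgraph) (S T : {set join G H}) :
  2 <= omega G -> 2 <= omega H -> general_position S ->
  omega G + omega H <= #|S| -> legal_move S T ->
  exists b, {in S, forall x, on_side b x} /\ {in T, forall x, on_side b x}.
Proof.
move=> oG oH gpS leS lST.
have [mS|/mixedPn[b bS]] := boolP (mixed S); first by case: (mixed_stuck oG oH gpS leS mS lST).
have [mT|/mixedPn[c cT]] := boolP (mixed T).
  case: (@mixed_stuck _ _ T S oG oH) => //; first exact: legal_move_gp lST.
    by rewrite (legal_move_card lST).
  exact: legal_move_sym.
exists b; split=> //; suff -> : b = c by [].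
have /legal_moveP[u [v [uS _ _ TE _]]] := lST.
have /card_gt0P[x] : 0 < #|S :\ u| by move: leS; rewrite (cardsD1 u S) uS; lia.
rewrite !inE => /andP[xu xS].
have := bS x xS; have : on_side c x by apply: cT; rewrite TE !inE xu xS orbT.
by case: (x) => ?; case: (b); case: (c).
Qed.

Lemma path_same_side (G H : sgraph) (S : {set join G H})
    (Ss : seq {set join G H}) (b : bool) :
  2 <= omega G -> 2 <= omega H -> general_position S ->
  omega G + omega H <= #|S| -> path (@legal_move (join G H)) S Ss ->
  {in S, forall x, on_side b x} ->
  {in S :: Ss, forall T : {set join G H}, {in T, forall x, on_side b x}}.
Proof.
move=> oG oH; elim: Ss S => [|U Ss IH] S gpS leS /=.
  by move=> _ bS T; rewrite inE => /eqP->.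
move=> /andP[lSU pU] bS T; rewrite inE => /predU1P[->//|].
apply: IH => //; first exact: legal_move_gp lSU.
  by rewrite (legal_move_card lSU).
have [c [cS cU]] := legal_move_same_side oG oH gpS leS lSU.
suff -> : b = c by [].
have /card_gt0P[x xS] : 0 < #|S| by lia.
by have := bS x xS; have := cS x xS; case: (x) => ?; case: (b); case: (c).
Qed.

Lemma mob_join_le (G H : sgraph) :
  2 <= omega G -> 2 <= omega H -> ~ (is_complete G /\ is_complete H) ->
  mob (join G H) <= omega G + omega H - 1.
Proof.
move=> oG oH nc; apply/bigmax_leqP => S /asboolP[gpS [Ss [pS vis]]].
rewrite leqNgt; apply/negP => ltS.
have leS : omega G + omega H <= #|S| by lia.
have [mS|/mixedPn[b bS]] := boolP (mixed S); last first.
  have /card_gt0P[g _] := leq_trans (ltnW oG) (omega_le_card G).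
  have /card_gt0P[h _] := leq_trans (ltnW oH) (omega_le_card H).
  have side := path_same_side oG oH gpS leS pS bS.
  have [T /side sT gT] := vis (inl g); have [U /side sU hU] := vis (inr h).
  by move: (sT _ gT) (sU _ hU); case: (b).
case: Ss pS vis => [_ vis|T Ss /andP[lST _] _]; last exact: mixed_stuck lST.
(* Without any move, [S] itself covers the join; being a clique, it forces both factors to be
   complete. *)
have allS x : x \in S by have [T] := vis x; rewrite inE => /eqP->.
have /cliqueP cS := mixed_clique gpS mS.
apply: nc; split=> x y ne; first exact: (cS (inl x) (inl y)).
exact: (cS (inr x) (inr y)).
Qed.

(** * Joins with a single vertex *)

Lemma mob_cone_ge (G : sgraph) (g : G) : 2 <= mob (join G (complete_graph 1)).
Proof.
set J := join _ _; pose h : J := inr ord0; pose S : {set J} := [set inl g; h].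
have cS : #|S| = 2 by rewrite cards2.
rewrite -[X in X <= _]cS; apply: (leq_bigmax_cond (F := fun S : {set J} => #|S|)).
apply/asboolP/mobile_connect; first by apply: general_position_card2; rewrite cS.
move=> v; have [vS|vS] := boolP (v \in S); first by exists S.
(* The robot on the apex [h] steps onto [v] while the other stays put; two robots are always in
   general position. *)
exists (v |: (S :\ h)); last by rewrite !inE eqxx.
apply/connect1/legal_moveP; exists h, v; split=> //.
- by rewrite !inE eqxx orbT.
- by case: v vS => // i; rewrite !inE [i]ord1 eqxx orbT.
- apply: general_position_card2; rewrite cardsU1 !inE.
  by move: cS; rewrite (cardsD1 h S) !inE eqxx orbT; case: (~~ _) => /=; lia.
Qed.

(* The configuration visiting the apex is a clique. *)
Lemma mob_cone_le (G : sgraph) :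
  mob (join G (complete_graph 1)) <= omega G + 1.
Proof.
apply/bigmax_leqP => S /asboolP[gpS [Ss [pS vis]]].
have [T TS hT] := vis (inr ord0).
(* Moves preserve general position and the number of robots, so it suffices to bound the
   configuration [T] that occupies the apex. *)
have [gpT <-] : general_position T /\ #|T| = #|S|.
  elim: Ss S gpS pS TS {vis} => [|U Ss IH] S gpS /=.
    by move=> _; rewrite inE => /eqP->.
  move=> /andP[lSU pU]; rewrite inE => /predU1P[->//|TU].
  rewrite -(legal_move_card lSU); apply: IH => //; exact: legal_move_gp lSU.
apply: leq_trans (_ : omega G + omega (complete_graph 1) <= _); last first.
  by rewrite leq_add2l (leq_trans (omega_le_card _)) // card_ord.
apply: join_clique_card; have clT := general_position_cluster gpT.
apply/cliqueP => -[x|x] [y|y] xT yT ne //.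
(* The apex is a common neighbour of [x] and [y] within [T]. *)
by apply: (clT (inl x) (inr ord0) (inl y)).
Qed.

Theorem theorem4p4 :
  (forall G H : sgraph,
     2 <= omega G -> 2 <= omega H ->
     ~ (is_complete G /\ is_complete H) ->
     minn (omega G) (omega H) + 1 <= mob (join G H)
       <= omega G + omega H - 1) /\
  (forall G : sgraph,
     2 <= #|G| ->
     2 <= mob (join G (complete_graph 1)) <= omega G + 1).
Proof.
split=> [G H oG oH nc|G cG].
  by rewrite mob_join_le // mob_join_ge //; lia.
have /card_gt0P[g _] : 0 < #|G| by lia.
by rewrite (mob_cone_ge g) mob_cone_le.
Qed.
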